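(* Let $X$ be a finite Helly complex, and let $z\in V(X)$. For every vertex $x\in V(X)$ there exists a vertex $w\in V(\partial X)$ such that $x\in I_X(z,w)$, i.e. $d_X(z,x)+d_X(x,w)=d_X(z,w)$.
   Context: Simplicial complexes. A (finite) simplicial complex $X$ is a set of nonempty subsets (simplices) of a finite set such that any nonempty subset of a simplex is a simplex. The dimension of a simplex $\sigma$ is $|\sigma|-1$. If $\sigma$ has dimension $k$, its facets are the simplices of dimension $k-1$ contained in $\sigma$. A simplex is maximal if it is maximal by inclusion, and non-maximal otherwise. $V(X)$ is the set of vertices ($0$-simplices), and $G(X)=X^{(1)}$ is the $1$-skeleton, viewed as a graph. For connected $X$, $d_X(u,v)$ is the least number of edges of a $(u,v)$-path in $G(X)$. The interval between $u$ and $v$ is $I_X(u,v)=\{x\in V(X): d_X(u,x)+d_X(x,v)=d_X(u,v)\}$. Helly complexes. A Helly graph is a connected graph in which every collection of pairwise intersecting balls (for the graph distance) has nonempty intersection. The clique complex of a graph is the simplicial complex whose simplices are the vertex sets of the (nonempty) cliques of the graph. A Helly complex is the clique complex of a Helly graph. Combinatorial boundary. $\partial X$ is the downward closure (all nonempty subsets) of the set of all non-maximal simplices of $X$ that are a facet of exactly one simplex of $X$. Convention: if $X$ consists of a single vertex, then $\partial X = X$. *)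

(* Defs.v *)
From HB Require Import structures.
From mathcomp Require Import all_boot.

Set Implicit Arguments.
Unset Strict Implicit.
Unset Printing Implicit Defensive.

(* All graphs and complexes have their vertices in an ambient finite type T,
   but need not use every element of T as a vertex. *)

Record graph (T : finType) := Graph {
  gverts : {set T};
  gadj : rel T;
  gadj_sym : symmetric gadj;
  gadj_irrefl : irreflexive gadj;
  gadj_verts : forall x y, gadj x y -> x \in gverts
}.

Section GraphMetric.
Variables (T : finType) (G : graph T).

Definition walk_of_length (u v : T) (n : nat) : bool :=
  [exists p : n.-tuple T, path (gadj G) u p && (last u p == v)].

(* The least n < #|T| such that there is a walk of length n from u to v. Since
   shortest paths have fewer than #|T| edges, the junk value #|T| is returned
   exactly when u and v are not connected: see gdist_le and gdistP. *)
Definition gdist (u v : T) : nat :=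
  find (walk_of_length u v) (iota 0 #|T|).

Definition gball (x : T) (r : nat) : {set T} :=
  [set y in gverts G | gdist x y <= r].

Definition gconnected : Prop :=
  {in gverts G &, forall u v, connect (gadj G) u v}.

(* Balls are finite sets of vertices, so any collection of balls is an element
   of {set {set T}}. *)
Definition helly_graph : Prop :=
  gconnected /\
  forall F : {set {set T}},
    (forall B, B \in F -> exists x r, x \in gverts G /\ B = gball x r) ->
    {in F &, forall B C, B :&: C != set0} ->
    exists2 y, y \in gverts G & forall B, B \in F -> y \in B.

Lemma gdist_le u p : path (gadj G) u p -> gdist u (last u p) <= size p.
Proof.
move=> up; case: (shortenP up) => q uq Uq sqp.
have szq : size q < #|T|.
  by have := max_card (mem (u :: q)); rewrite (card_uniqP Uq).
have szqp : size q <= size p.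
  by case/andP: Uq => _ Uq; apply: uniq_leq_size sqp.
apply: leq_trans szqp; rewrite leqNgt; apply/negP => lt.
have /negP[] := negbT (before_find 0 lt); rewrite nth_iota // add0n.
by apply/existsP; exists (in_tuple q); rewrite uq eqxx.
Qed.

Lemma gdistP u v : connect (gadj G) u v ->
  exists p, [/\ path (gadj G) u p, last u p = v & size p = gdist u v].
Proof.
case/connectP => p up ->; case: (shortenP up) => q uq Uq _.
have szq : size q < #|T|.
  by have := max_card (mem (u :: q)); rewrite (card_uniqP Uq).
have hasw : has (walk_of_length u (last u q)) (iota 0 #|T|).
  apply/hasP; exists (size q); first by rewrite mem_iota.
  by apply/existsP; exists (in_tuple q); rewrite uq eqxx.
have lt : gdist u (last u q) < #|T|.
  by rewrite -[#|T| in X in _ < X](size_iota 0) -has_find.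
have := nth_find 0 hasw; rewrite -/(gdist _ _) nth_iota // add0n.
by case/existsP=> r /andP[ur /eqP lr]; exists r; rewrite size_tuple.
Qed.

End GraphMetric.

Definition is_complex (T : finType) (X : {set {set T}}) : bool :=
  (set0 \notin X) &&
  [forall s in X, forall t : {set T}, (t != set0) && (t \subset s) ==> (t \in X)].

Record complex (T : finType) := Complex {
  simplices :> {set {set T}};
  complexP : is_complex simplices
}.

HB.instance Definition _ (T : finType) := [isSub for @simplices T].

Section Complexes.
Variable T : finType.
Implicit Types (X : complex T) (G : graph T) (s t : {set T}).

Lemma simplex_neq0 X s : s \in simplices X -> s != set0.
Proof. by case/andP: (complexP X) => X0 _; apply: contraTneq => ->. Qed.

Lemma simplex_sub X s t :
  s \in simplices X -> t != set0 -> t \subset s -> t \in simplices X.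
Proof.
case/andP: (complexP X) => _ /forall_inP cl sX t0 ts.
by have /forallP/(_ t) := cl s sX; rewrite t0 ts.
Qed.

Definition verts X : {set T} := [set x | [set x] \in simplices X].

(* Dimension of a nonempty s; for set0, which is never a simplex, .-1
   truncates to 0. *)
Definition dim s : nat := #|s|.-1.

Definition facet X t s : bool :=
  [&& t \in simplices X, t \subset s & dim s == (dim t).+1].

Definition maximal_simplex X s : bool := maxset [in simplices X] s.

Definition skeleton_adj X (x y : T) : bool :=
  (x != y) && ([set x; y] \in simplices X).

Lemma skeleton_adj_sym X : symmetric (skeleton_adj X).
Proof. by move=> x y; rewrite /skeleton_adj eq_sym setUC. Qed.

Lemma skeleton_adj_irrefl X : irreflexive (skeleton_adj X).
Proof. by move=> x; rewrite /skeleton_adj eqxx. Qed.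

Lemma skeleton_adj_verts X x y : skeleton_adj X x y -> x \in verts X.
Proof.
case/andP=> _ xyX; rewrite inE; apply: (simplex_sub xyX).
  by rewrite -card_gt0 cards1.
by rewrite sub1set set21.
Qed.

Definition skeleton X : graph T :=
  Graph (@skeleton_adj_sym X) (@skeleton_adj_irrefl X) (@skeleton_adj_verts X).

Definition dist X (u v : T) : nat := gdist (skeleton X) u v.

Definition interval X (u v : T) : {set T} :=
  [set x in verts X | dist X u x + dist X x v == dist X u v].

Definition cliques G : {set {set T}} :=
  [set s : {set T} | [&& s != set0, s \subset gverts G &
     [forall x in s, forall y in s, (x != y) ==> gadj G x y]]].

Lemma cliques_complex G : is_complex (cliques G).
Proof.
apply/andP; split; first by rewrite inE eqxx.
apply/forall_inP=> s; rewrite inE => /and3P[_ sG /forall_inP cl].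
apply/forallP=> t; apply/implyP=> /andP[t0 ts].
rewrite inE t0 (subset_trans ts sG); apply/forall_inP=> x xt.
apply/forall_inP=> y yt; have /forall_inP := cl x (subsetP ts x xt).
by apply; apply: (subsetP ts).
Qed.

Definition clique_complex G : complex T := Complex (cliques_complex G).

Definition helly_complex X : Prop :=
  exists2 G : graph T, helly_graph G & X = clique_complex G.

Definition free_facets X : {set {set T}} :=
  [set t in simplices X |
    ~~ maximal_simplex X t & #|[set s in simplices X | facet X t s]| == 1].

Definition down_closure (F : {set {set T}}) : {set {set T}} :=
  [set t : {set T} | (t != set0) && [exists s in F, t \subset s]].

Lemma down_closure_complex F : is_complex (down_closure F).
Proof.
apply/andP; split; first by rewrite inE eqxx.
apply/forall_inP=> s; rewrite inE => /andP[_ /exists_inP[r rF sr]].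
apply/forallP=> t; apply/implyP=> /andP[t0 ts]; rewrite inE t0.
by apply/exists_inP; exists r => //; apply: subset_trans sr.
Qed.

(* A complex with a single vertex is its own boundary, by convention: the
   general formula would give the empty complex. *)
Definition boundary X : complex T :=
  if [exists v, simplices X == [set [set v]]] then X
  else Complex (down_closure_complex (free_facets X)).

End Complexes.

(* Main.v *)
Require Import Defs.
From mathcomp Require Import all_boot.

Set Implicit Arguments.
Unset Strict Implicit.
Unset Printing Implicit Defensive.

(** Among all vertices [w] such that [x] lies on a geodesic from [z] to [w],
    choose one farthest from [z].  No neighbour of [w] is farther from [z] than
    [w], since a geodesic through [x] could otherwise be prolonged to it
    ([interval_extend]).  If [w] differs from [z], put [k = d(z, w) > 0]: the
    ball of radius [k - 1] around [z] meets every unit ball around a vertex of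
    the closed neighbourhood of [w], and these unit balls all contain [w].  The
    Helly property yields a vertex [u], distinct from [w] because it is closer
    to [z], adjacent or equal to every vertex of the closed neighbourhood of
    [w]: the vertex [w] is dominated by [u] ([helly_peak_dominated]).

    In a clique complex domination makes the link of [w] a cone with apex [u].
    A simplex that is maximal among those containing [w] and avoiding [u] then
    extends by [u] and by no other vertex, so it is a free facet, and [w] lies
    in the boundary ([dominated_in_boundary]).

    If [w = z], then [z] has no neighbour, and by connectedness the complex is
    the single vertex [z], which is its own boundary. *)

(** * Distances in a graph *)

Section Distance.
Variables (T : finType) (G : graph T).

Lemma gdist_refl u : gdist G u u = 0.
Proof. by apply/eqP; rewrite -leqn0 (@gdist_le _ G u [::]). Qed.

Lemma gdist_adj u v : gadj G u v -> gdist G u v <= 1.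
Proof. by move=> uv; rewrite (@gdist_le _ G u [:: v]) //= uv. Qed.

Lemma gdist_eq0 u v : connect (gadj G) u v -> gdist G u v = 0 -> u = v.
Proof. by case/gdistP=> p [_ <- <-] /size0nil ->. Qed.

Lemma gdist_le1 u v :
  connect (gadj G) u v -> gdist G u v <= 1 -> u = v \/ gadj G u v.
Proof.
case/gdistP=> [[|a [|b p]]] [up <- <-] // _; first by left.
by right; move: up => /= /andP[].
Qed.

Lemma gdist_triangle u v w :
  connect (gadj G) u v -> connect (gadj G) v w ->
  gdist G u w <= gdist G u v + gdist G v w.
Proof.
case/gdistP=> p [up lp <-] /gdistP[q [vq <- <-]].
rewrite -size_cat -lp -last_cat gdist_le // cat_path up lp //.
Qed.

Lemma gadj_verts_r u v : gadj G u v -> v \in gverts G.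
Proof. by rewrite gadj_sym => /gadj_verts. Qed.

(** The penultimate vertex of a geodesic gives the common point; when the
    geodesic is trivial, its only vertex does. *)
Lemma ball_meets_unit_ball z y k :
  z \in gverts G -> connect (gadj G) z y -> gdist G z y <= k.+1 ->
  gball G z k :&: gball G y 1 != set0.
Proof.
move=> zG /gdistP[p [zp <- <-]] szp; apply/set0Pn.
case/lastP: p zp szp => [|p a] zp szp.
  by exists z; rewrite !inE zG !gdist_refl.
move: zp szp; rewrite rcons_path last_rcons size_rcons ltnS => /andP[zp pa] sp.
exists (last z p); rewrite !inE (gadj_verts pa) (leq_trans (gdist_le zp) sp).
by rewrite gdist_adj // gadj_sym.
Qed.

(** The path from [x] to [w] followed by the edge to [y] shows that [d(x, y)]
    is at most [d(x, w) + 1]; the triangle inequality gives the converse bound. *)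
Lemma interval_extend z x w y :
  connect (gadj G) z x -> connect (gadj G) x w -> gadj G w y ->
  gdist G z x + gdist G x w = gdist G z w -> gdist G z w < gdist G z y ->
  gdist G z x + gdist G x y = gdist G z y.
Proof.
move=> zx xw wy e lt; have cwy := connect1 wy.
apply/eqP; rewrite eqn_leq gdist_triangle ?(connect_trans xw cwy) // andbT.
apply: leq_trans lt; rewrite -e -addnS leq_add2l -addn1.
by rewrite (leq_trans (gdist_triangle xw cwy)) // leq_add2l gdist_adj.
Qed.

End Distance.

(** * Dominated vertices *)

Section Domination.
Variables (T : finType) (G : graph T).

(** For adjacent [u] and [w], inclusion of the closed neighbourhood of [w] in
    that of [u]. *)
Definition dominates (u w : T) : Prop :=
  gadj G w u /\ forall y, gadj G w y -> y = u \/ gadj G y u.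

(** A common point of the ball around [z] that just misses [w] and of the unit
    balls around the closed neighbourhood of [w] dominates [w]; maximality of
    the distance is what makes the former ball meet each of the latter. *)
Lemma helly_peak_dominated z w :
  helly_graph G -> z \in gverts G -> w \in gverts G -> w != z ->
  (forall y, gadj G w y -> gdist G z y <= gdist G z w) ->
  exists u, dominates u w.
Proof.
case=> conn helly zG wG wz peak.
have [k kE] : exists k, gdist G z w = k.+1.
  case E: (gdist G z w) => [|k]; last by exists k.
  by rewrite (gdist_eq0 (conn z w zG wG) E) eqxx in wz.
pose N := [set y | (y == w) || gadj G w y].
have NG y : y \in N -> y \in gverts G.
  by rewrite inE => /orP[/eqP -> // | /gadj_verts_r].
have wN y : y \in N -> w \in gball G y 1.
  rewrite !inE wG => /orP[/eqP ->|wy]; first by rewrite gdist_refl.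
  by rewrite gdist_adj // gadj_sym.
have zN y : y \in N -> gball G z k :&: gball G y 1 != set0.
  move=> yN; apply: ball_meets_unit_ball => //; first exact: conn (NG y yN).
  by rewrite -kE; move: yN; rewrite inE => /orP[/eqP -> | /peak].
have [||u uG uF] := helly (gball G z k |: [set gball G y 1 | y in N]).
- move=> B /setU1P[-> | /imsetP[y yN ->]]; first by exists z, k.
  by exists y, 1; split; first exact: NG.
- move=> B C /setU1P[-> | /imsetP[y yN ->]] /setU1P[-> | /imsetP[y' y'N ->]].
  + by rewrite setIid; apply/set0Pn; exists z; rewrite inE zG gdist_refl.
  + exact: zN.
  + by rewrite setIC zN.
  + by apply/set0Pn; exists w; rewrite inE !wN.
have near y : y \in N -> y = u \/ gadj G y u.
  move=> yN; apply: gdist_le1; first exact: conn (NG y yN) uG.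
  have /uF : gball G y 1 \in gball G z k |: [set gball G y 1 | y in N].
    by rewrite setU1r // imset_f.
  by rewrite inE => /andP[].
exists u; split; last by move=> y wy; apply: near; rewrite inE wy orbT.
have [||//] := near w; first by rewrite inE eqxx.
(* [u] lies in the ball of radius [k] around [z], and [w] does not. *)
move=> wu; have := uF _ (setU11 _ _).
by rewrite inE -wu kE ltnn andbF.
Qed.

Lemma cliqueP (s : {set T}) :
  reflect [/\ s != set0, s \subset gverts G &
             {in s &, forall x y, x != y -> gadj G x y}]
          (s \in cliques G).
Proof.
rewrite inE; apply: (iffP and3P) => -[s0 sG cl]; split=> //.
  by move=> x y xs ys; apply/implyP; move/forall_inP/(_ x xs)/forall_inP: cl; apply.
by apply/forall_inP=> x xs; apply/forall_inP=> y ys; apply/implyP; exact: cl.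
Qed.

Lemma verts_clique_complex : verts (clique_complex G) = gverts G.
Proof.
apply/setP=> x; rewrite inE; apply/cliqueP/idP => [[_ /subsetP-> //]|xG].
  by rewrite set11.
split; rewrite ?sub1set //; first by rewrite -card_gt0 cards1.
by move=> a b /set1P-> /set1P->; rewrite eqxx.
Qed.

Lemma skeleton_clique_complex : skeleton_adj (clique_complex G) =2 gadj G.
Proof.
move=> x y; apply/andP/idP => [[xy /cliqueP[_ _ ->]] | xy]; rewrite ?set21 ?set22 //.
have nxy : x != y by apply: contraTneq xy => ->; rewrite gadj_irrefl.
split=> //; apply/cliqueP; split.
- by apply/set0Pn; exists x; rewrite set21.
- by apply/subsetP=> a /set2P[]->; rewrite ?(gadj_verts xy) ?(gadj_verts_r xy).
- by move=> a b /set2P[]-> /set2P[]->; rewrite ?eqxx // gadj_sym.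
Qed.

Lemma dist_clique_complex u v : dist (clique_complex G) u v = gdist G u v.
Proof.
apply: eq_find => n; apply: eq_existsb => p.
by rewrite (eq_path skeleton_clique_complex).
Qed.

Lemma card_facet (X : complex T) (t s : {set T}) :
  s \in simplices X -> facet X t s -> #|s| = #|t|.+1.
Proof.
move=> /simplex_neq0 s0 /and3P[/simplex_neq0 t0 _ /eqP].
by rewrite /dim prednK ?card_gt0 // => <-; rewrite prednK ?card_gt0.
Qed.

(** The link of [w] is a cone with apex [u]: a maximal simplex of the base of
    the cone, joined with [w], can only be extended by [u]. *)
Lemma dominated_in_boundary u w :
  dominates u w -> w \in verts (boundary (clique_complex G)).
Proof.
set X := clique_complex G => -[wu dom]; have wG := gadj_verts wu.
have wX : [set w] \in simplices X.
  by have := wG; rewrite -verts_clique_complex inE.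
rewrite /boundary; case: ifP => _; rewrite inE //.
have nwu : w != u by apply: contraTneq wu => ->; rewrite gadj_irrefl.
pose P := [pred t : {set T} | [&& t \in cliques G, w \in t & u \notin t]].
have [t /maxsetP[/and3P[tX wt ut] tmax] _] : {t | maxset P t & [set w] \subset t}.
  by apply: maxset_exists; rewrite /= wX !inE eqxx eq_sym.
have [t0 tG tcl] := cliqueP _ tX.
have tu y : y \in t -> gadj G y u.
  move=> yt; have [-> //|yw] := eqVneq y w.
  by have [] := dom y (tcl _ _ wt yt _); rewrite 1?eq_sym // => yu; rewrite -yu yt in ut.
have utX : u |: t \in simplices X.
  apply/cliqueP; split; first by apply/set0Pn; exists u; rewrite setU11.
    by rewrite subUset sub1set tG (gadj_verts_r wu).
  move=> a b /setU1P[->|at_] /setU1P[->|bt]; rewrite ?eqxx //.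
  - by rewrite gadj_sym tu.
  - by rewrite tu.
  - exact: tcl.
have fut : facet X t (u |: t).
  by rewrite /facet tX subsetUr /dim cardsU1 ut add1n prednK ?card_gt0 /=.
rewrite /= inE -card_gt0 cards1 /=; apply/exists_inP; exists t; last by rewrite sub1set.
rewrite inE tX /=; apply/andP; split.
  apply/negP=> /maxsetP[_ mt]; have e := mt _ utX (subsetUr _ _).
  by rewrite -e setU11 in ut.
apply/cards1P; exists (u |: t); apply/setP=> s.
rewrite in_set1 in_set; apply/andP/eqP => [[sX ts]|-> //].
have cs := @card_facet X t s sX ts; have /and3P[_ tsub _] := ts.
have us : u \in s.
  apply: contra_eqT cs => us; rewrite (tmax s) //; last first.
    by rewrite /= sX (subsetP tsub _ wt).
  by rewrite neq_ltn leqnn.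
by apply: esym; apply/eqP; rewrite eqEcard subUset sub1set us tsub cs cardsU1 ut /=.
Qed.

(** By connectedness an isolated vertex is the whole complex, so the convention
    for a single vertex applies. *)
Lemma isolated_boundary z :
  gconnected G -> z \in gverts G -> (forall y, ~~ gadj G z y) ->
  z \in verts (boundary (clique_complex G)).
Proof.
move=> conn zG iso; rewrite -verts_clique_complex in zG.
rewrite /boundary; case: ifP => // /existsP[]; exists z.
have only_z y : y \in gverts G -> y = z.
  rewrite verts_clique_complex in zG => yG.
  case/connectP: (conn z y zG yG) => [[|a p]] //= /andP[za _] _.
  by rewrite (negbTE (iso a)) in za.
rewrite eqEsubset sub1set [X in _ && X](_ : _ = true); last by rewrite inE in zG.
rewrite andbT; apply/subsetP=> s /cliqueP[s0 /subsetP sG _]; rewrite inE.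
rewrite eqEcard cards1 card_gt0 s0 andbT.
by apply/subsetP=> y /sG/only_z ->; rewrite set11.
Qed.

End Domination.

(** * Prolonging geodesics to the boundary *)

Theorem proposition4p1 (T : finType) (X : complex T) (z x : T) :
  helly_complex X -> z \in verts X -> x \in verts X ->
  exists2 w : T, w \in verts (boundary X) & x \in interval X z w.
Proof.
move=> [G hG ->]; rewrite verts_clique_complex => zG xG.
have [conn _] := hG.
pose P w := (w \in gverts G) && (gdist G z x + gdist G x w == gdist G z w).
have Px : P x by rewrite /P xG gdist_refl addn0 eqxx.
case: (arg_maxnP (gdist G z) Px) => w /andP[wG /eqP xw] wmax.
have peak y : gadj G w y -> gdist G z y <= gdist G z w.
  move=> wy; rewrite leqNgt; apply/negP => lt.
  have /wmax : P y.
    rewrite /P (gadj_verts_r wy); apply/eqP.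
    by apply: (interval_extend _ _ wy xw lt); apply: conn.
  by rewrite /= leqNgt lt.
exists w; last by rewrite inE verts_clique_complex xG !dist_clique_complex xw eqxx.
have [wz|wz] := eqVneq w z.
  rewrite wz in peak *; apply: isolated_boundary => // y.
  apply/negP => zy; have := peak y zy; rewrite gdist_refl leqn0 => /eqP.
  move/(gdist_eq0 (connect1 zy)) => e.
  by rewrite e gadj_irrefl in zy.
by have [u /dominated_in_boundary] := helly_peak_dominated hG zG wG wz peak.
Qed.
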